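(* Let $n\ge 3$ and $d\ge 2$ be integers, and set $g_{max}=\binom{d-2}{2}-(n-3)$ if $d\ge 3$ and $g_{max}=2-n$ if $d=2$. Then for every integer $g\le g_{max}$ there exists a non-degenerate curve $C\subset\mathbb{P}^n$ of degree $d$ and arithmetic genus $g$.
   Context: $\mathbb{P}^n$ is projective $n$-space over an algebraically closed field $K$ of characteristic zero. A curve $C\subset\mathbb{P}^n$ is a closed subscheme that is locally Cohen-Macaulay of pure dimension $1$; it is non-degenerate if it is not contained in a hyperplane. *)

(* Defs.v *)
From HB Require Import structures.
From mathcomp Require Import all_boot all_order all_algebra.
From mathcomp Require Import mpoly.
Set Implicit Arguments. Unset Strict Implicit. Unset Printing Implicit Defensive.
Import GRing.Theory.
Local Open Scope ring_scope.

(* Projective n-space P^n over K: homogeneous coordinate ring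
   S = K[x_0,...,x_n] = {mpoly K[n.+1]}.  Closed subschemes of P^n are
   represented by their saturated homogeneous ideals. *)
Section Curves.
Variables (K : fieldType) (n : nat).
Local Notation S := {mpoly K[n.+1]}.

(* p is homogeneous of degree t (0 is homogeneous of every degree) *)
Definition homog_of (t : nat) (p : S) : Prop :=
  forall m, m \in msupp p -> mdeg m = t.

Definition hcomp (t : nat) (p : S) : S :=
  \sum_(m <- msupp p | mdeg m == t) p@_m *: 'X_[m].

Definition is_homog_ideal (I : S -> Prop) : Prop :=
  [/\ I 0,
      (forall p q, I p -> I q -> I (p + q)),
      (forall p q, I p -> I (q * p)) &
      (forall p t, I p -> I (hcomp t p))].

Definition lin_indep (s : seq S) : Prop :=
  forall c : seq K, size c = size s ->
    \sum_(i < size s) c`_i *: s`_i = 0 -> forall i, c`_i = 0.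

(* the K-subspace A (assumed to be one) has dimension r *)
Definition dim_is (A : S -> Prop) (r : nat) : Prop :=
  (exists s : seq S, [/\ size s = r, (forall p, p \in s -> A p) & lin_indep s])
  /\ (forall s : seq S, (forall p, p \in s -> A p) -> lin_indep s -> (size s <= r)%N).

(* Hilbert function of S/I in degree t equals h:
   h = dim_K S_t - dim_K I_t, with dim_K S_t = binom(t+n, n) *)
Definition hilb_fun (I : S -> Prop) (t : nat) (h : int) : Prop :=
  exists r, dim_is (fun p => I p /\ homog_of t p) r /\
            h = ('C(t + n, n))%:Z - r%:Z.

Definition hilb_poly_lin (I : S -> Prop) (a b : int) : Prop :=
  exists t0 : nat, forall t : nat, (t0 <= t)%N -> hilb_fun I t (a * t%:Z + b).

Definition saturated (I : S -> Prop) : Prop :=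
  forall f : S, (forall i : 'I_n.+1, exists k : nat, I ('X_i ^+ k * f)) -> I f.

Definition prime_homog_ideal (P : S -> Prop) : Prop :=
  [/\ is_homog_ideal P, ~ P 1 & forall p q, P (p * q) -> P p \/ P q].

Definition assoc_prime (I P : S -> Prop) : Prop :=
  prime_homog_ideal P /\ exists f : S, forall q, P q <-> I (q * f).

Definition one_dim_prime (P : S -> Prop) : Prop :=
  exists a b : int, 0 < a /\ hilb_poly_lin P a b.

(* I is the (saturated homogeneous) ideal of a curve in P^n, i.e. a closed
   subscheme that is locally Cohen-Macaulay of pure dimension 1:
   S/I has a degree-1 Hilbert polynomial and every associated prime of I
   defines a 1-dimensional irreducible subvariety (no embedded or isolated
   points, no higher-dimensional components). *)
Definition is_curve (I : S -> Prop) : Prop :=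
  [/\ is_homog_ideal I, saturated I,
      (exists a b : int, 0 < a /\ hilb_poly_lin I a b) &
      (forall P, assoc_prime I P -> one_dim_prime P)].

Definition curve_deg_genus (I : S -> Prop) (d : nat) (g : int) : Prop :=
  hilb_poly_lin I d%:Z (1 - g).

Definition nondeg_curve (I : S -> Prop) : Prop :=
  forall p : S, homog_of 1 p -> I p -> p = 0.

End Curves.

Definition g_max (n d : nat) : int :=
  if (3 <= d)%N then ('C(d - 2, 2))%:Z - (n%:Z - 3) else 2 - n%:Z.

(* Main.v *)
(* The curve is a d-fold structure on a line.  Map the coordinate ring to
   K[s,t,u] by monomials: x_0 -> s, x_1 -> t, x_2 -> t^M u and
   x_(l+3) -> s^(N-l) t^(l+M(d-2)) u^(d-1), with N = C(d-2,2) - g and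
   M = N + d - 2, and let I be the preimage of (u^d).  The ideal (u^d) is
   (u)-primary, so the only associated prime of I is the preimage of (u), the
   ideal of the line x_2 = ... = x_n = 0, and I is saturated.  The map sends
   monomials to monomials, so the Hilbert function of I counts the monomials
   not divisible by u^d in the image of degree t.  For large t, the power u^k
   contributes t - k + 1 of them if k < d - 1, and t + N of them if k = d - 1:
   geometrically, this is a (d-1)-fold line in a plane, doubled once more in
   the other directions.  The bound on g makes the images of the coordinates
   distinct, and none is divisible by u^d, hence I contains no linear form. *)
Require Import Defs.
From HB Require Import structures.
From mathcomp Require Import all_boot all_order all_algebra.
From mathcomp Require Import mpoly.
From mathcomp Require Import zify ring.
Set Implicit Arguments. Unset Strict Implicit. Unset Printing Implicit Defensive.
Import Order.TTheory GRing.Theory Num.Theory.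
Local Open Scope ring_scope.

(** * Hilbert functions of kernels of monomial maps *)

Lemma enum_monomials (n t : nat) : exists M : seq 'X_{1..n.+1},
  [/\ uniq M, size M = 'C(t + n, n) & forall m, (m \in M) = (mdeg m == t)].
Proof.
exists [seq s2m u | u : t.-tuple 'I_n.+1 <- enum (basis n.+1 t)]; split.
- exact: uniq_basis.
- by rewrite size_basis -[LHS]bin_sub ?leq_addr // addKn.
- by move=> m; rewrite basis_cover.
Qed.

Section MonomialMap.
Variables (K : fieldType) (n : nat) (T : eqType).
Local Notation S := {mpoly K[n.+1]}.
Variables (phi : 'X_{1..n.+1} -> T) (D : pred T).

(** This is the coordinate at [b] of the image of [p] under the linear map sending ['X_[m]] to the
    basis vector [phi m]; [mker] is the kernel of that map followed by projection to the coordinates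
    in [D]. *)
Definition fiber_sum (b : T) (p : S) : K := \sum_(m <- msupp p | phi m == b) p@_m.

Definition mker (p : S) : Prop := forall b, D b -> fiber_sum b p = 0.

Lemma fiber_sum_sub (M : seq 'X_{1..n.+1}) b p : uniq M -> {subset msupp p <= M} ->
  fiber_sum b p = \sum_(m <- M | phi m == b) p@_m.
Proof.
move=> uM sub; rewrite /fiber_sum [RHS](bigID (fun m => m \in msupp p)) /=.
rewrite [X in _ = _ + X]big1 ?addr0; last by move=> m /andP[_ /memN_msupp_eq0].
rewrite -big_filter -[RHS]big_filter; apply: perm_big; apply: uniq_perm.
- exact/filter_uniq/msupp_uniq.
- exact: filter_uniq.
move=> m; rewrite !mem_filter; case: (boolP (m \in msupp p)) => [mp|_].
  by rewrite (sub _ mp) !andbT.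
by rewrite !andbF.
Qed.

(** The degree is constant on a fibre over [D], so taking the component of degree [t] either keeps
    the fibre sum of [p] or leaves only zero terms. *)
Lemma mker_hcomp t p :
  {in [pred m | D (phi m)] &, forall m m', phi m = phi m' -> mdeg m = mdeg m'} ->
  mker p -> mker (hcomp t p).
Proof.
move=> Hdeg Hp b Db.
have cE m : (hcomp t p)@_m = if mdeg m == t then p@_m else 0.
  rewrite /hcomp raddf_sum /=.
  transitivity (\sum_(i <- msupp p | (mdeg i == t) && (i == m)) p@_i).
    rewrite big_mkcondr /=; apply: eq_bigr => i _.
    by rewrite mcoeffZ mcoeffX; case: (i == m); rewrite ?mulr1 ?mulr0.
  have [mp|mp] := boolP (m \in msupp p); last first.
    rewrite (memN_msupp_eq0 mp) if_same big_seq_cond big1 // => i /and3P[ip _ /eqP im].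
    by rewrite -im ip in mp.
  rewrite -big_filter; have [mt|mt] := boolP (mdeg m == t); last first.
    rewrite big_filter big1 // => i /andP[it /eqP im]; by rewrite -im it in mt.
  transitivity (\sum_(i <- [:: m]) p@_i); last by rewrite big_seq1.
  apply: perm_big; apply: uniq_perm => // [|i]; first exact/filter_uniq/msupp_uniq.
  rewrite mem_filter inE; case: (eqVneq i m) => [->|]; first by rewrite mt.
  by rewrite andbF.
have sub : {subset msupp (hcomp t p) <= msupp p}.
  by move=> m; rewrite !mcoeff_msupp cE; case: ifP; rewrite ?eqxx.
rewrite (fiber_sum_sub _ (msupp_uniq p) sub).
case: (boolP (has (fun m => (phi m == b) && (mdeg m == t)) (msupp p))) => [/hasP|/hasPn H].
  case=> m0 _ /andP[/eqP m0b /eqP m0t]; transitivity (fiber_sum b p); last exact: Hp.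
  apply: eq_bigr => m /eqP mb.
  by rewrite cE -m0t (Hdeg m m0) ?inE ?mb ?m0b // m0t eqxx.
rewrite big_seq_cond big1 // => m /andP[mp mb]; rewrite cE.
by move/(_ _ mp): H; rewrite mb /= => /negbTE->.
Qed.

Section HilbertFunction.
Variables (t : nat) (codes : seq T) (rep : T -> 'X_{1..n.+1}).
Hypothesis codes_uniq : uniq codes.
Hypothesis codesP : forall m, mdeg m = t -> D (phi m) -> phi m \in codes.
Hypothesis repP : forall b, b \in codes -> [/\ phi (rep b) = b, mdeg (rep b) = t & D b].

(* A basis: the monomials outside the image of rep, corrected by the
   representative of their fibre. *)
Lemma mker_dim (M B : seq 'X_{1..n.+1}) : uniq M -> (forall m, (m \in M) = (mdeg m == t)) ->
  B = [seq m <- M | m \notin map rep codes] ->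
  dim_is (fun p : S => mker p /\ homog_of t p) (size B).
Proof.
move=> uM MP BE.
have uB : uniq B by rewrite BE filter_uniq.
have BP m : (m \in B) = (m \notin map rep codes) && (mdeg m == t) by rewrite BE mem_filter MP.
have subM (p : S) : homog_of t p -> {subset msupp p <= M}.
  by move=> hp m /hp mt; rewrite MP mt.
have LE b (p : S) : homog_of t p -> fiber_sum b p = \sum_(m <- M | phi m == b) p@_m.
  by move=> hp; exact: fiber_sum_sub uM (subM _ hp).
split.
  pose v m : S := 'X_[m] - (if D (phi m) then 'X_[rep (phi m)] else 0).
  exists (map v B); split; first by rewrite size_map.
    move=> p /mapP[m mB ->].
    move: (mB); rewrite BP => /andP[_ /eqP mt].
    have hv : homog_of t (v m).
      move=> m' /msuppB_le; rewrite mem_cat msuppX inE => /orP[/eqP->//|].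
      case: ifP => [Dm|_]; last by rewrite msupp0.
      by rewrite msuppX inE => /eqP->; case: (repP (codesP mt Dm)).
    split=> // b Db; rewrite LE //.
    under eq_bigr do rewrite mcoeffB.
    have sumX m1 : m1 \in M -> \sum_(i <- M | phi i == b) ('X_[m1] : S)@_i = (phi m1 == b)%:R.
      move=> m1M; rewrite (big_rem m1) //= mcoeffX eqxx big1_seq; last first.
        move=> i /andP[_]; rewrite mem_rem_uniq // inE mcoeffX eq_sym.
        by case/andP=> /negbTE->.
      by rewrite addr0; case: ifP.
    rewrite sumrB sumX ?MP ?mt //.
    case: ifP => Dm.
      have [rb rt _] := repP (codesP mt Dm).
      by rewrite sumX ?MP ?rt // rb subrr.
    rewrite big1 ?subr0; last by move=> i _; rewrite mcoeff0.
    by case: eqP => // mb; rewrite -mb Dm in Db.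
  move=> c; rewrite size_map => sc H i.
  case: (ltnP i (size B)) => [iB|]; last by move=> ?; rewrite nth_default ?sc.
  have := congr1 (fun p : S => p@_(nth 0%MM B i)) H.
  rewrite mcoeff0 raddf_sum /= (bigD1 (Ordinal iB)) //= big1 ?addr0.
    rewrite mcoeffZ (nth_map 0%MM) // mcoeffB mcoeffX eqxx.
    have := mem_nth 0%MM iB; rewrite BP => /andP[Ni /eqP it].
    case: ifP => [Dm|_]; last by rewrite mcoeff0 subr0 mulr1.
    rewrite mcoeffX; case: eqP => [E|_]; last by rewrite subr0 mulr1.
    by rewrite -E map_f ?codesP in Ni.
  move=> j; rewrite -val_eqE /= => ji; rewrite mcoeffZ (nth_map 0%MM) // mcoeffB mcoeffX.
  rewrite nth_uniq // (negbTE ji).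
  have := mem_nth 0%MM iB; rewrite BP => /andP[Ni /eqP it].
  case: ifP => [Dm|_]; last by rewrite mcoeff0 subr0 mulr0.
  rewrite mcoeffX; case: eqP => [E|_]; last by rewrite subr0 mulr0.
  have := mem_nth 0%MM (ltn_ord j); rewrite BP => /andP[_ /eqP jt].
  by rewrite -E map_f ?codesP in Ni.
(* More than [size B] elements have a nontrivial combination [p] without monomials from [B]. It
   involves only representatives, one per fibre, so each coefficient is a fibre sum and vanishes. *)
move=> s sA indep; rewrite leqNgt; apply/negP => lt.
pose C := \matrix_(i < size s, j < size B) (s`_i)@_(nth 0%MM B j).
have : kermx C != 0.
  rewrite kermx_eq0 /row_free; apply: contraTN lt => /eqP <-.
  by rewrite -leqNgt rank_leq_col.
case/rowV0Pn => c /sub_kermxP cC c0.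
pose cs := [seq c 0 i | i <- enum 'I_(size s)].
have scs : size cs = size s by rewrite size_map size_enum_ord.
have csE (i : 'I_(size s)) : cs`_i = c 0 i.
  by rewrite (nth_map i) ?size_enum_ord // nth_ord_enum.
pose p := \sum_(i < size s) cs`_i *: s`_i.
have hp : homog_of t p.
  move=> m /msupp_sum_le /flattenP[l /mapP[i _ ->]] /msuppZ_le.
  by apply: (proj2 (sA _ (mem_nth _ (ltn_ord i)))).
have kp : mker p.
  move=> b Db; rewrite LE // /p.
  under eq_bigr do rewrite raddf_sum /=.
  rewrite exchange_big big1 // => i _ /=.
  under eq_bigr do rewrite mcoeffZ.
  have [ki hi] := sA _ (mem_nth 0 (ltn_ord i)).
  by rewrite -mulr_sumr -LE // ki // mulr0.
have pB m : m \in B -> p@_m = 0.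
  move=> mB; move/matrixP: cC => /(_ 0 (Ordinal (ltac:(by rewrite index_mem) : (index m B < size B)%N))).
  rewrite !mxE => <-; rewrite raddf_sum /=; apply: eq_bigr => i _.
  by rewrite mcoeffZ csE !mxE /= nth_index.
have p0 : p = 0.
  apply/eqP; rewrite -msupp_eq0; case E: (msupp p) => [//|m l].
  have mp : m \in msupp p by rewrite E mem_head.
  have inR m' : m' \in msupp p -> m' \in map rep codes.
    move=> m'p; apply: contraTT (m'p) => N.
    by rewrite mcoeff_msupp pB ?eqxx // BP N; apply/eqP/hp.
  have /mapP[b bc mb] := inR _ mp.
  have [rb rt Db] := repP bc.
  have := kp b Db; rewrite /fiber_sum (big_rem m) //= mb rb eqxx -mb.
  rewrite big1_seq ?addr0 => [/eqP|m']; first by rewrite mcoeff_eq0 mp.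
  rewrite mem_rem_uniq ?msupp_uniq // inE => /and3P[/eqP m'b Nm m'p].
  have /mapP[b' b'c m'b'] := inR _ m'p; have [rb' _ _] := repP b'c.
  by case/negP: Nm; rewrite m'b' mb -rb' -m'b' m'b.
case/negP: c0; apply/eqP/rowP => i; rewrite mxE -csE; exact: indep p0 i.
Qed.

Lemma mker_hilb_fun (I : S -> Prop) : (forall p, I p <-> mker p) ->
  hilb_fun I t (size codes)%:Z.
Proof.
move=> IE; have [M [uM sM MP]] := enum_monomials n t.
pose B := [seq m <- M | m \notin map rep codes].
have [[s [ss sA si]] sB] := mker_dim uM MP (erefl B).
have inj : {in codes &, injective rep}.
  by move=> b b' /repP[rb _ _] /repP[rb' _ _] E; rewrite -rb E rb'.
have sz : (size B + size codes)%N = 'C(t + n, n).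
  rewrite -sM /B size_filter -(count_predC (fun m => m \notin map rep codes)); congr addn.
  rewrite -size_filter -(size_map rep); apply/perm_size/uniq_perm.
  - by rewrite map_inj_in_uniq.
  - exact: filter_uniq.
  move=> m; rewrite mem_filter /= negbK MP.
  by case: mapP => // -[b /repP[_ rt _] ->]; rewrite rt eqxx.
exists (size B); split; last by rewrite -sz PoszD addrAC subrr add0r.
split; first by exists s; split=> // p /sA[/IE].
by move=> s' A'; apply: sB => p /A'[/IE].
Qed.
End HilbertFunction.
End MonomialMap.

(** * Preimages of powers of (u) under a monomial ring map *)

Section ToricPrimary.
Variables (K : fieldType) (n : nat) (ws wt wu : 'I_n.+1 -> nat).
Local Notation S := {mpoly K[n.+1]}.
Local Notation R := {poly {poly {poly K}}}.

Definition stu (a b c : nat) : R := ('X^a)%:P%:P * ('X^b)%:P * 'X^c.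

Definition toric : S -> R :=
  mmap (polyC \o polyC \o polyC : {rmorphism K -> R}) (fun i => stu (ws i) (wt i) (wu i)).

HB.instance Definition _ := GRing.RMorphism.on toric.

(* toric maps 'X_[m] to s^i t^j u^k where (i, j, k) = toric_exp m. *)
Definition toric_exp (m : 'X_{1..n.+1}) : nat * nat * nat :=
  (\sum_i ws i * m i, \sum_i wt i * m i, \sum_i wu i * m i)%N.

Lemma toricE p : toric p =
  \sum_(m <- msupp p)
    (p@_m)%:P%:P%:P * stu (toric_exp m).1.1 (toric_exp m).1.2 (toric_exp m).2.
Proof.
rewrite /toric /mmap; apply: eq_bigr => m _; congr (_ * _).
rewrite /mmap1 /stu /=.
under eq_bigr => i _ do rewrite !exprMn -!rmorphXn -!exprM.
by rewrite !big_split /= -!rmorph_prod /= !prodrXr.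
Qed.

Lemma coef_toric p i j k : (toric p)`_k`_j`_i = fiber_sum toric_exp (i, j, k) p.
Proof.
rewrite toricE !coef_sum /fiber_sum [RHS]big_mkcond; apply: eq_bigr => m _.
case: (toric_exp m) => [[a b] c] /=; rewrite /stu !mulrA -!rmorphM /=.
rewrite !xpair_eqE coefCM coefXn eq_sym; case: (c == k); last by rewrite mulr0 !coef0 andbF.
rewrite mulr1 coefCM coefXn eq_sym; case: (b == j); last by rewrite mulr0 coef0 andbF.
rewrite mulr1 coefCM coefXn eq_sym; case: (a == i); first by rewrite mulr1.
by rewrite mulr0.
Qed.

(** The preimage of (u^e): [u] is the outermost variable of [R], so the coefficients below [e]
    detect divisibility by u^e. *)
Definition toric_ideal (e : nat) (p : S) : Prop := forall k, (k < e)%N -> (toric p)`_k = 0.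

Lemma toric_ideal_mker e p :
  toric_ideal e p <-> mker toric_exp (fun b => b.2 < e)%N p.
Proof.
split=> [H [[i j] k] /= ke|H k ke]; first by rewrite -coef_toric H // !coef0.
by apply/polyP => j; apply/polyP => i; rewrite coef_toric !coef0 (H (i, j, k)).
Qed.

Lemma toric_idealM e e' p q :
  toric_ideal e p -> toric_ideal e' q -> toric_ideal (e + e') (p * q).
Proof.
move=> Hp Hq k ke; rewrite rmorphM coefM big1 // => i _.
case: (ltnP i e) => ie; first by rewrite Hp ?mul0r.
by rewrite Hq ?mulr0 //; have := ltn_ord i; lia.
Qed.

(* The ideal (u^e) is (u)-primary, and this passes to preimages. *)
Lemma toric_ideal_cancel e p q :
  ~ toric_ideal 1 q -> toric_ideal e (q * p) -> toric_ideal e p.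
Proof.
move=> Hq Hqp; elim/ltn_ind => k IH ke.
(* By induction, only the product of the constant coefficient of [toric q] and the [k]-th one of
   [toric p] survives, and K[s,t] is a domain. *)
have := Hqp k ke; rewrite rmorphM coefM big_ord_recl big1 ?addr0 /=; last first.
  by move=> i _; rewrite IH ?mulr0 //=; have := ltn_ord i; rewrite /bump /=; lia.
rewrite subn0 => /eqP; rewrite mulf_eq0 => /orP[/eqP q0|/eqP //].
by case: Hq => -[|//] _.
Qed.

Lemma toric_ideal_homog e : (0 < e)%N ->
  (forall m m', toric_exp m = toric_exp m' -> mdeg m = mdeg m') ->
  is_homog_ideal (toric_ideal e).
Proof.
move=> e0 Hdeg; split.
- by move=> k _; rewrite rmorph0 coef0.
- by move=> p q Hp Hq k ke; rewrite rmorphD coefD Hp // Hq // addr0.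
- by move=> p q Hp; apply: (@toric_idealM 0).
- move=> p t /toric_ideal_mker Hp; apply/toric_ideal_mker; apply: mker_hcomp Hp.
  by move=> m m' _ _; apply: Hdeg.
Qed.

(** Here P = (I : f) with f outside I. Primariness puts P inside the preimage of (u); conversely, q
    in that preimage has q^e in I, hence in P, and P is prime. *)
Lemma toric_ideal_assoc e P : assoc_prime (toric_ideal e) P ->
  forall q, P q <-> toric_ideal 1 q.
Proof.
move=> [[[_ _ PM _] P1 Ppr] [f Pf]].
have If : ~ toric_ideal e f by move=> If; apply: P1; apply/Pf; rewrite mul1r.
move=> q; split=> [/Pf Iqf k k1|Iq].
  apply/eqP/negPn/negP => q0; apply: If; apply: toric_ideal_cancel Iqf => /(_ k k1) /eqP.
  exact/negP.
have : P (q ^+ e).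
  apply/Pf; rewrite -[e]addn0; apply: toric_idealM => //.
  rewrite -[X in toric_ideal X]mul1n; elim: e {If Pf} => [//|e IH].
  by rewrite exprS mulnS; apply: toric_idealM.
by elim: e {If Pf} => [/P1|e IH]; rewrite // exprS => /Ppr[].
Qed.

(** The variable ['X_i] maps to a nonzero element of K[s,t], so its powers can be cancelled modulo
    the ideal. *)
Lemma toric_ideal_saturated e i : wu i = 0%N -> saturated (toric_ideal e).
Proof.
move=> wi f /(_ i)[k]; apply: toric_ideal_cancel => /(_ 0%N isT).
rewrite rmorphXn /= /toric mmapX mmap1U /stu wi mulr1 -!rmorphM -!rmorphXn coefC /=.
move/eqP; rewrite expf_eq0 => /andP[_].
by rewrite mulf_eq0 polyC_eq0 !expf_eq0 !polyX_eq0 !andbF.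
Qed.

(** The variables have distinct images, so each coefficient of a linear form is a whole fibre
    sum. *)
Lemma toric_ideal_nondeg e :
  (forall i, (wu i < e)%N) -> injective (fun i => (ws i, wt i, wu i)) ->
  nondeg_curve (toric_ideal e).
Proof.
move=> we inj p hp /toric_ideal_mker Hp.
have expU i : toric_exp U_(i) = (ws i, wt i, wu i).
  have sU (w : 'I_n.+1 -> nat) : (\sum_j w j * U_(i)%MM j)%N = w i.
    rewrite (bigD1 i) //= mnm1E eqxx muln1 big1 ?addn0 // => j ji.
    by rewrite mnm1E eq_sym (negbTE ji) muln0.
  by rewrite /toric_exp !sU.
apply/eqP; rewrite -msupp_eq0; case E: (msupp p) => [//|m l].
have mp : m \in msupp p by rewrite E mem_head.
have /eqP/mdeg1P[i /eqP mi] := hp m mp.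
have em : toric_exp m = (ws i, wt i, wu i) by rewrite mi expU.
have := Hp (ws i, wt i, wu i) (we i).
rewrite /fiber_sum (big_rem m) //= em eqxx big1_seq ?addr0 => [/eqP|m'].
  by rewrite mcoeff_eq0 mp.
rewrite mem_rem_uniq ?msupp_uniq // inE => /and3P[/eqP].
move=> m'm Nm m'p; have /eqP/mdeg1P[j /eqP mj] := hp m' m'p.
by move: m'm Nm; rewrite mi mj expU => /inj->; rewrite eqxx.
Qed.
End ToricPrimary.

(** * The multiple line and its invariants *)

Section MultipleLine.
Variables (K : fieldType) (n d N : nat).
Hypothesis n3 : (3 <= n)%N.
Hypothesis nN : (n - 3 <= N)%N.

(** With deg u = 1 - M, this value gives the image of x_(l+3) degree N + M d + (d + 1)(1 - M) = 1,
    as for the other variables. *)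
Let M := (N + d)%N.

(* Exponents of s, t and u in the image of x_i, for curves of degree d + 2. *)
Definition line_ws i := match i with 0 => 1 | 1 | 2 => 0 | l.+3 => N - l end%N.
Definition line_wt i := match i with 1 => 1 | 0 => 0 | 2 => M | l.+3 => l + M * d end%N.
Definition line_wu i := match i with 0 | 1 => 0 | 2 => 1 | _ => d.+1 end%N.

Definition line_exp : 'X_{1..n.+1} -> nat * nat * nat :=
  @toric_exp n (fun i => line_ws i) (fun i => line_wt i) (fun i => line_wu i).

Lemma big_ord3 (F : nat -> nat) :
  (\sum_(i < n.+1) F i = F 0 + F 1 + F 2 + \sum_(i < n - 2) F i.+3)%N.
Proof.
have -> : n.+1 = (n - 2).+3 by lia.
by rewrite !big_ord_recl /= !addnA.
Qed.

(* m0, m1, m2 are the exponents of x_0, x_1, x_2; q, V and W are the sums of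
   m_(l+3), (N - l) m_(l+3) and l m_(l+3). *)
Variant line_exp_spec (m : 'X_{1..n.+1}) : nat * nat * nat -> nat -> Prop :=
  LineExpSpec m0 m1 m2 q V W of (V + W = N * q)%N :
    line_exp_spec m ((m0 + V), (m1 + M * m2 + W + M * d * q), (m2 + d.+1 * q))%N
      (m0 + m1 + m2 + q).

Lemma line_expP m : line_exp_spec m (line_exp m) (mdeg m).
Proof.
(* Exponents indexed by [nat] allow the sums to be split at literal indices. *)
pose f i := m (inord i).
have fE (w : nat -> nat) : (\sum_(i < n.+1) w i * m i = \sum_(i < n.+1) w i * f i)%N.
  by apply: eq_bigr => i _; rewrite /f inord_val.
have := @LineExpSpec m (f 0%N) (f 1%N) (f 2%N) (\sum_(l < n - 2) f l.+3)
  (\sum_(l < n - 2) (N - l) * f l.+3) (\sum_(l < n - 2) l * f l.+3).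
have -> : mdeg m = (f 0 + f 1 + f 2 + \sum_(l < n - 2) f l.+3)%N.
  rewrite mdegE -(big_ord3 f); by apply: eq_bigr => i _; rewrite /f inord_val.
rewrite /line_exp /toric_exp !fE.
rewrite (big_ord3 (fun i => line_ws i * f i)%N) (big_ord3 (fun i => line_wt i * f i)%N).
rewrite (big_ord3 (fun i => line_wu i * f i)%N) /=.
rewrite !mul1n !mul0n !addn0 !add0n.
have -> : (\sum_(l < n - 2) (l + M * d) * f l.+3 =
  \sum_(l < n - 2) l * f l.+3 + M * d * \sum_(l < n - 2) f l.+3)%N.
  by rewrite big_distrr -big_split; apply: eq_bigr => l _; rewrite mulnDl.
have -> : (\sum_(l < n - 2) d.+1 * f l.+3 = d.+1 * \sum_(l < n - 2) f l.+3)%N.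
  by rewrite big_distrr.
rewrite addnA; apply; rewrite -big_split big_distrr; apply: eq_bigr => l _ /=.
(* Here [l <= n - 3 <= N], so the subtraction [N - l] is not truncated. *)
by rewrite -mulnDl subnK //; have := ltn_ord l; lia.
Qed.

(* K[s,t,u] is graded so that the map is homogeneous: deg u = 1 - M. *)
Lemma line_exp_mdeg m m' : line_exp m = line_exp m' -> mdeg m = mdeg m'.
Proof.
(* The weight i + j + (1 - M) k, with M k moved to the left to stay in [nat]. *)
suff H m1 : (mdeg m1 + M * (line_exp m1).2 =
    (line_exp m1).1.1 + (line_exp m1).1.2 + (line_exp m1).2)%N.
  by move=> E; apply: (@addIn (M * (line_exp m).2)); rewrite H E H.
case: (line_expP m1) => m0 {}m1 m2 q V W VW /=; rewrite /M; nia.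
Qed.

(** For k <= d, only x_2^k times monomials in x_0, x_1 occur. For k = d + 1, x_2^(d+1) gives the
    s-exponents up to t - d - 1 and x_3 those from N to N + t - 1; together they fill 0, ..., N + t
    - 1 once t >= N + d. *)
Definition line_count t k := (if k <= d then (t - k).+1 else t + N)%N.

(** The exponent of t is determined by the grading with deg u = 1 - M. *)
Definition line_codes e t : seq (nat * nat * nat) :=
  [seq (i, t + M * k - k - i, k)%N | k <- iota 0 e, i <- iota 0 (line_count t k)].

Definition mnm4 (a b c e : nat) : 'X_{1..n.+1} :=
  [multinom nth 0%N [:: a; b; c; e] i | i < n.+1].

(* A preimage of the monomial s^i t^j u^k involving only x_0, ..., x_3. *)
Definition line_rep (b : nat * nat * nat) : 'X_{1..n.+1} :=
  let: (i, j, k) := b in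
  if (k == d.+1) && (N <= i)%N then mnm4 (i - N) (j - M * d) 0 1
  else mnm4 i (j - M * k) k 0.

Lemma big_mnm4 (w : nat -> nat) a b c e :
  (\sum_(i < n.+1) w i * mnm4 a b c e i = w 0 * a + w 1 * b + w 2 * c + w 3 * e)%N.
Proof.
under eq_bigr do rewrite mnmE.
rewrite (big_ord3 (fun i => w i * nth 0 [:: a; b; c; e] i)%N) /=.
have -> : (n - 2 = (n - 3).+1)%N by lia.
by rewrite big_ord_recl /= big1 ?addn0 // => i _; rewrite nth_nil muln0.
Qed.

Lemma mdeg_mnm4 a b c e : mdeg (mnm4 a b c e) = (a + b + c + e)%N.
Proof.
rewrite mdegE; under eq_bigr do rewrite -[mnm4 _ _ _ _ _]mul1n.
by rewrite (big_mnm4 (fun=> 1%N)) !mul1n.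
Qed.

Lemma line_exp_mnm4 a b c e :
  line_exp (mnm4 a b c e) = (a + N * e, b + M * c + M * d * e, c + d.+1 * e)%N.
Proof.
by rewrite /line_exp /toric_exp !big_mnm4 /= !mul1n !mul0n !addn0 !add0n subn0.
Qed.

Lemma line_codesP e t m : (e <= d.+2)%N ->
  mdeg m = t -> ((line_exp m).2 < e)%N -> line_exp m \in line_codes e t.
Proof.
move=> ed; case: (line_expP m) => m0 m1 m2 q V W VW /= <- ke.
apply/allpairsPdep; exists (m2 + d.+1 * q)%N, (m0 + V)%N.
rewrite !mem_iota /= add0n /line_count.
(* The exponent of u is at most d + 1, so a variable beyond x_2 occurs at most once, and then
   without x_2. *)
have [q0|q1] : (q = 0 \/ q = 1 /\ m2 = 0)%N by nia.
  subst q; split=> //; first by case: ifP; lia.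
  by congr (_, _, _); nia.
case: q1 => ? ?; subst q m2; split=> //; first by case: ifP; lia.
by congr (_, _, _); rewrite /M in VW *; nia.
Qed.

Lemma line_repP e t b : (e <= d.+2)%N -> (N + d <= t)%N -> b \in line_codes e t ->
  [/\ line_exp (line_rep b) = b, mdeg (line_rep b) = t & (b.2 < e)%N].
Proof.
move=> ed tl /allpairsPdep[k [i []]]; rewrite !mem_iota !add0n /= /line_count => ke.
move=> ic -> /=.
case: ifP => [/andP[/eqP kd Ni]|C]; rewrite line_exp_mnm4 mdeg_mnm4.
  subst k; move: ic; rewrite ltnn => ic.
  by split=> //; [congr (_, _, _)|]; rewrite /M; nia.
(* This makes the x_1-exponent t - k - i nonnegative. When k = d + 1, failure of the test in
   [line_rep] gives i < N, so k + i <= N + d <= t. *)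
have ik : (k + i <= t)%N.
  by move: ic C; case: ifP => kd ic; [lia | have -> : k = d.+1 by [lia]; rewrite eqxx /=; lia].
have kM : (t + M * k - k - i = M * k + (t - (k + i)))%N by lia.
by split=> //; [congr (_, _, _)|]; rewrite ?kM; lia.
Qed.

Lemma uniq_line_codes e t : uniq (line_codes e t).
Proof.
apply: allpairs_uniq_dep; [exact: iota_uniq | by move=> *; exact: iota_uniq |].
by move=> [k i] [k' i'] _ _ /= [-> _ ->].
Qed.

Lemma size_line_codes e t :
  size (line_codes e t) = (\sum_(k < e) line_count t k)%N.
Proof.
rewrite size_allpairs_dep sumnE big_map -{1}[e]subn0 -/(index_iota 0 e) big_mkord.
by apply: eq_bigr => k _; rewrite size_iota.
Qed.

Definition line_ideal : nat -> {mpoly K[n.+1]} -> Prop :=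
  @toric_ideal K n (fun i => line_ws i) (fun i => line_wt i) (fun i => line_wu i).

Lemma line_ideal_hilb e t : (e <= d.+2)%N -> (N + d <= t)%N ->
  hilb_fun (line_ideal e) t (\sum_(k < e) line_count t k)%:Z.
Proof.
move=> ed tl; rewrite -size_line_codes.
apply: (mker_hilb_fun (rep := line_rep) (uniq_line_codes e t) _ _
  (toric_ideal_mker _ _ _ e)) => [m|b].
  exact: line_codesP.
exact: line_repP.
Qed.

Lemma sum_line_count t : (d <= t)%N ->
  ((\sum_(k < d.+2) line_count t k)%:Z = d.+2%:Z * t%:Z + (1 + N%:Z - 'C(d, 2)%:Z)).
Proof.
move=> dt; rewrite big_ord_recr /= {2}/line_count ltnn.
(* The terms (t - k) + 1 with k <= d; the binomial stands on the left to avoid subtraction. *)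
have S m : (m <= d.+1)%N -> (\sum_(k < m) line_count t k + 'C(m, 2) = m * t.+1)%N.
  elim: m => [|m IH] mt; first by rewrite big_ord0.
  rewrite big_ord_recr /= binS bin1 {2}/line_count -ltnS mt.
  move: (\sum_(k < m) _)%N (IH (ltnW mt)) => sm; lia.
move: (\sum_(k < d.+1) _)%N (S d.+1 (leqnn _)) => sm; rewrite binS bin1; lia.
Qed.

Lemma line_ideal_homog e : (0 < e)%N -> is_homog_ideal (line_ideal e).
Proof. by move=> e0; apply: toric_ideal_homog => // m m'; apply: line_exp_mdeg. Qed.

Lemma line_ideal_deg_genus :
  curve_deg_genus (line_ideal d.+2) d.+2 ('C(d, 2)%:Z - N%:Z).
Proof.
exists (N + d)%N => t tl.
have -> : d.+2%:Z * t%:Z + (1 - ('C(d, 2)%:Z - N%:Z)) = (\sum_(k < d.+2) line_count t k)%:Z.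
  by rewrite sum_line_count; [ring | lia].
exact: line_ideal_hilb.
Qed.

Lemma line_ideal_curve : is_curve (line_ideal d.+2).
Proof.
split.
- exact: line_ideal_homog.
- exact: (@toric_ideal_saturated _ _ _ _ _ _ ord0).
- by exists d.+2, (1 - ('C(d, 2)%:Z - N%:Z)); split=> //; exact: line_ideal_deg_genus.
(* Every associated prime equals [line_ideal 1], whose Hilbert polynomial is that of a line, t +
   1. *)
move=> P aP; have PE := toric_ideal_assoc aP; exists 1, 1; split=> //.
exists (N + d)%N => t tl.
have [r [[[s [sr sP si]] ub] hr]] := line_ideal_hilb (isT : 1 <= d.+2)%N tl.
exists r; split; last first.
  by rewrite -hr big_ord1 /line_count /= subn0; lia.
split; first by exists s; split=> // p /sP[/PE].
by move=> s' sP'; apply: ub => p /sP'[/PE].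
Qed.

(** For d = 0 the images of x_2, ..., x_n all have u-exponent 1, and that of x_2, t^N u, would equal
    that of x_(l+3) for l = N. The extra bound excludes this; it is why degree 2 has its own
    [g_max]. *)
Lemma line_ideal_nondeg : (d = 0%N -> (n - 2 <= N)%N) -> nondeg_curve (line_ideal d.+2).
Proof.
move=> d0; apply: toric_ideal_nondeg => [[i /= _]|].
  by case: i => [|[|[|i]]] /=.
move=> [i Hi] [j Hj] /= [Es Et Eu]; apply: val_inj => /=.
move: i j Hi Hj Es Et Eu => [|[|[|i]]] [|[|[|j]]] //=; rewrite /M; lia.
Qed.
End MultipleLine.

Theorem theorem3p2 (K : closedFieldType) (hK : has_pchar0 K)
  (n d : nat) (hn : (3 <= n)%N) (hd : (2 <= d)%N) (g : int) (hg : g <= g_max n d) :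
  exists I : {mpoly K[n.+1]} -> Prop,
    [/\ is_curve I, nondeg_curve I & curve_deg_genus I d g].
Proof.
case: d hd hg => [|[|d]] // _; rewrite /g_max => hg.
(* The value of N is dictated by [line_ideal_deg_genus], the degree now being d + 2. The bound on g
   becomes N >= n - 3, or N >= n - 2 in degree 2. *)
have [N NE] : exists N : nat, N%:Z = 'C(d, 2)%:Z - g.
  exists `|'C(d, 2)%:Z - g|%N; apply: gez0_abs.
  by move: hg; case: ifP => _; rewrite ?subSS ?subn0; [lia|];
    have := leq0n 'C(d, 2); lia.
have gE : g = 'C(d, 2)%:Z - N%:Z by rewrite NE; ring.
have nN : (n - 3 <= N)%N by move: hg; case: ifP => _; rewrite ?subSS ?subn0; lia.
exists (@line_ideal K n d N d.+2); rewrite gE; split.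
- exact: line_ideal_curve.
- by apply: line_ideal_nondeg => // d0; move: hg; rewrite gE d0 /=; lia.
- exact: line_ideal_deg_genus.
Qed.
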